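(* Let $\phi$ be a polynomial map of height $0$ defined over $\mathbb{Q}$. If a rational number $\alpha$ is preperiodic for $\phi$, then $\alpha$ is either $0$, $\pm 1$, or $\pm 2$.
   Context: A polynomial map defined over $\mathbb{Q}$ is a rational map $\phi = (f_0 : f_1) \colon \mathbb{P}^1 \to \mathbb{P}^1$ of degree $d \geq 2$, given by homogeneous polynomials $f_0, f_1 \in \mathbb{Q}[X_0,X_1]$ of degree $d$ without common zero in $\mathbb{P}^1(\overline{\mathbb{Q}})$, for which one can take $f_1 = X_1^d$. Writing $f_0 = \sum_{j=0}^d a_j X_0^{d-j}X_1^j$ and $f_1 = X_1^d$, the height of $\phi$ is $h(\phi) = h((a_0 : \dots : a_d : 1))$, where $h$ is the logarithmic height on projective space over $\mathbb{Q}$: for coprime integers $x_0, \dots, x_N$, $h((x_0 : \dots : x_N)) = \log\max\{|x_0|, \dots, |x_N|\}$. The degree $d \ge 2$ is arbitrary. A rational number $\alpha$ is identified with the point $(\alpha : 1) \in \mathbb{P}^1(\mathbb{Q})$. A point $P \in \mathbb{P}^1(\mathbb{Q})$ is preperiodic for $\phi$ if there exist integers $n \geq 0$ and $m \geq 1$ such that $\phi^{n+m}(P) = \phi^n(P)$, where $\phi^k$ denotes the $k$-th iterate. *)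

(* Defs.v *)
From HB Require Import structures.
From mathcomp Require Import all_boot all_order all_algebra generic_quotient.
From mathcomp Require Import ring.
From mathcomp Require Import algC.
From mathcomp Require Import reals exp.

Set Implicit Arguments.
Unset Strict Implicit.
Unset Printing Implicit Defensive.

Import Order.TTheory GRing.Theory Num.Theory.
Local Open Scope ring_scope.
Local Open Scope quotient_scope.

Definition nzvec (F : fieldType) (n : nat) := {x : 'rV[F]_n.+1 | x != 0}.

(* Proportionality, as equality of row spaces: see [same_lineP]. *)
Definition same_line (F : fieldType) (n : nat) (x y : nzvec F n) : bool :=
  (val x == val y)%MS.

Lemma same_lineP (F : fieldType) (n : nat) (x y : nzvec F n) :
  reflect (exists2 c : F, c != 0 & val x = c *: val y) (same_line x y).
Proof.
apply: (iffP idP) => [/andP[/sub_rVP[c xE] _]|[c c0 xE]].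
  exists c => //; apply/eqP => c0.
  by move: (valP x); rewrite /= xE c0 scale0r eqxx.
by apply/eqmxP; rewrite xE; apply: eqmx_scale.
Qed.

Lemma same_line_refl (F : fieldType) n : reflexive (@same_line F n).
Proof. by move=> x; rewrite /same_line submx_refl. Qed.

Lemma same_line_sym (F : fieldType) n : symmetric (@same_line F n).
Proof. by move=> x y; rewrite /same_line andbC. Qed.

Lemma same_line_trans (F : fieldType) n : transitive (@same_line F n).
Proof.
move=> y x z /andP[xy yx] /andP[yz zy].
by rewrite /same_line (submx_trans xy yz) (submx_trans zy yx).
Qed.

Canonical same_line_equiv (F : fieldType) (n : nat) :=
  EquivRel (@same_line F n) (@same_line_refl F n)
    (@same_line_sym F n) (@same_line_trans F n).

Definition proj (F : fieldType) (n : nat) := {eq_quot (same_line_equiv F n)}.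
HB.instance Definition _ (F : fieldType) (n : nat) := Choice.on (proj F n).
HB.instance Definition _ (F : fieldType) (n : nat) :=
  EqQuotient.on (proj F n).

Definition pt (F : fieldType) (n : nat) (x : 'rV[F]_n.+1) (x0 : x != 0) :
  proj F n := \pi_(proj F n) (exist _ x x0 : nzvec F n).

Definition coords (F : fieldType) (n : nat) (P : proj F n) : 'rV[F]_n.+1 :=
  val (repr P).

Lemma coords_neq0 (F : fieldType) n (P : proj F n) : coords P != 0.
Proof. exact: valP (repr P). Qed.

Lemma pt_coords (F : fieldType) n (P : proj F n) : pt (coords_neq0 P) = P.
Proof.
rewrite -[RHS]reprK /pt; congr (\pi_(proj F n) _).
exact: val_inj.
Qed.

Lemma pt_eqP (F : fieldType) n (x y : 'rV[F]_n.+1) (x0 : x != 0) (y0 : y != 0) :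
  reflect (exists2 c : F, c != 0 & x = c *: y) (pt x0 == pt y0).
Proof.
have -> : (pt x0 == pt y0) = same_line (exist _ x x0) (exist _ y y0).
  by rewrite /pt eqmodE.
exact: (same_lineP (exist _ x x0) (exist _ y y0)).
Qed.

Definition coprime_rV (n : nat) (z : 'rV[int]_n.+1) : bool :=
  \big[gcdn/0%N]_i absz (z 0 i) == 1%N.

Lemma coprime_rV_neq0 n (z : 'rV[int]_n.+1) :
  coprime_rV z -> map_mx intr z != 0 :> 'rV[rat]_n.+1.
Proof.
apply: contraTneq => z0; rewrite /coprime_rV big1 // => i _.
move/matrixP/(_ 0 i)/eqP: z0; rewrite !mxE intr_eq0 => /eqP->.
by rewrite absz0.
Qed.

Definition coprime_coords (n : nat) (P : proj rat n) (z : 'rV[int]_n.+1) :=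
  coprime_rV z && (map_mx intr z == coords P)%MS.

Lemma coprime_coords_ex n (P : proj rat n) : exists z, coprime_coords P z.
Proof.
have := coords_neq0 P; set x := coords P => x0.
pose D : int := \prod_i denq (x 0 i).
have D0 : D != 0 by apply/prodf_neq0 => i _; apply: denq_neq0.
pose w i : int := numq (x 0 i) * \prod_(j | j != i) denq (x 0 j).
have wE i : (w i)%:~R = D%:~R * x 0 i.
  rewrite [D](bigD1 i) //= /w !intrM numqE.
  by rewrite -!mulrA mulrC -mulrA.
pose g := \big[gcdn/0%N]_i `|w i|%N.
have gw i : (g %| `|w i|)%N by rewrite /g (biggcdn_inf i).
have g0 : (0 < g)%N.
  have [i xi] : exists i, x 0 i != 0.
    by move/matrix0Pn: x0 => [j [i]]; rewrite ord1; exists i.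
  apply: dvdn_gt0 (gw i); rewrite absz_gt0 -(intr_eq0 rat) wE mulf_neq0 //.
  by rewrite intr_eq0.
have gZ0 : g%:Z%:~R != 0 :> rat by rewrite intr_eq0 -lt0n.
have gK i : (w i %/ g%:Z)%Z * g%:Z = w i by rewrite divzK // dvdzE.
exists (\row_i (w i %/ g%:Z)%Z); apply/andP; split.
  rewrite /coprime_rV -dvdn1 -(dvdn_pmul2l g0) muln1.
  apply/dvdn_biggcdP => i _; rewrite -(gK i) abszM mulnC dvdn_pmul2r //.
  by rewrite (biggcdn_inf i) // mxE.
apply/eqmxP; rewrite -/x.
suff -> : map_mx intr (\row_i (w i %/ g%:Z)%Z) = (g%:Z%:~R^-1 * D%:~R) *: x.
  by apply: eqmx_scale; apply: mulf_neq0; rewrite ?invr_eq0 ?gZ0 ?intr_eq0.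
apply/rowP => i; rewrite !mxE -mulrA -wE -[in RHS](gK i) rmorphM /= mulrCA.
by rewrite mulVf ?mulr1.
Qed.

Definition coprime_repr (n : nat) (P : proj rat n) : 'rV[int]_n.+1 :=
  xchoose (coprime_coords_ex P).

Definition height (R : realType) (n : nat) (P : proj rat n) : R :=
  ln (\max_i absz (coprime_repr P 0%R i))%N%:R.

(* The height does not depend on the coprime representative. *)
Lemma heightE (R : realType) n (z : 'rV[int]_n.+1) (cz : coprime_rV z) :
  height R (pt (coprime_rV_neq0 cz)) = ln (\max_i absz (z 0%R i))%N%:R.
Proof.
set P := pt _; rewrite /height; congr (ln _%:R).
have /andP[] : coprime_coords P (coprime_repr P) by apply: xchooseP.
move: (coprime_repr P) => y cy yP.
have [c c0 yE] : exists2 c : rat, c != 0 & map_mx intr y = c *: map_mx intr z.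
  apply/(pt_eqP (coprime_rV_neq0 cy) (coprime_rV_neq0 cz)).
  rewrite -/P; apply/eqP; rewrite -[RHS]pt_coords; apply/eqP/pt_eqP.
  pose nz := fun x : 'rV[rat]_n.+1 => is_true (x != 0).
  exact: (elimT (same_lineP (exist nz _ (coprime_rV_neq0 cy))
                            (exist nz _ (coords_neq0 P)))).
have yzE i : denq c * y 0 i = numq c * z 0 i.
  apply: (@intr_inj rat); rewrite !rmorphM /=.
  move/rowP/(_ i): yE; rewrite !mxE => ->.
  by rewrite mulrA numqE [c * _]mulrC.
have gM (k : nat) (u : 'rV[int]_n.+1) : coprime_rV u ->
    \big[gcdn/0%N]_i (k * absz (u 0%R i))%N = k.
  move=> /eqP cu; apply/eqP; rewrite eqn_dvd; apply/andP; split; last first.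
    by apply/dvdn_biggcdP => i _; rewrite dvdn_mulr.
  have [->|k0] := posnP k; first by rewrite dvdn0.
  set G := \big[_/_]_i _.
  have /dvdnP[q Gq] : (k %| G)%N.
    by apply/dvdn_biggcdP => i _; rewrite dvdn_mulr.
  rewrite Gq -[X in (_ %| X)%N]mul1n dvdn_pmul2r // -cu.
  apply/dvdn_biggcdP => i _; rewrite -(dvdn_pmul2l k0) mulnC -Gq.
  by rewrite (biggcdn_inf i).
have nd : `|denq c|%N = `|numq c|%N.
  rewrite -(gM `|denq c|%N y) // -[RHS](gM `|numq c|%N z) //.
  by apply: eq_bigr => i _; rewrite -!abszM yzE.
apply: eq_bigr => i _; apply/eqP.
have d0 : (0 < `|denq c|)%N by rewrite absz_gt0 denq_neq0.
by rewrite -(eqn_pmul2l d0) -abszM yzE abszM nd.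
Qed.

(* The row [a] encodes the binary form \sum_j a_j X_0^(d-j) X_1^j. *)
Definition form_eval (K : comNzRingType) (d : nat) (a : 'rV[K]_d.+1)
    (x : 'rV[K]_2) : K :=
  \sum_(j < d.+1) a 0 j * x 0 0 ^+ (d - j) * x 0 1 ^+ j.

(* [algC] is the algebraic closure of the rationals. *)
Definition no_common_zero (d : nat) (f0 f1 : 'rV[rat]_d.+1) : Prop :=
  forall x : 'rV[algC]_2, x != 0 ->
    ~ (form_eval (map_mx ratr f0) x = 0 /\ form_eval (map_mx ratr f1) x = 0).

Record ratmap (d : nat) := RatMap {
  form0 : 'rV[rat]_d.+1;
  form1 : 'rV[rat]_d.+1;
  ratmap_no_common_zero : no_common_zero form0 form1
}.
Arguments ratmap_no_common_zero {d} phi [x] _ _ : rename.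

Definition row2 (K : Type) (a b : K) : 'rV[K]_2 :=
  \row_(i < 2) (if i == 0 then a else b).

Definition ratmap_coords (d : nat) (phi : ratmap d) (x : 'rV[rat]_2) :
  'rV[rat]_2 := row2 (form_eval (form0 phi) x) (form_eval (form1 phi) x).

Lemma form_eval_ratr d (a : 'rV[rat]_d.+1) (x : 'rV[rat]_2) :
  form_eval (map_mx ratr a) (map_mx ratr x) = ratr (form_eval a x) :> algC.
Proof.
rewrite /form_eval rmorph_sum; apply: eq_bigr => j _.
by rewrite !mxE !rmorphM !rmorphXn.
Qed.

Lemma ratmap_coords_neq0 d (phi : ratmap d) (x : 'rV[rat]_2) :
  x != 0 -> ratmap_coords phi x != 0.
Proof.
move=> x0; apply/eqP => /rowP e.
have x0' : map_mx ratr x != 0 :> 'rV[algC]_2 by rewrite map_mx_eq0.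
apply: (ratmap_no_common_zero phi x0'); rewrite !form_eval_ratr.
by move: (e 0) (e 1); rewrite !mxE /= => -> ->; rewrite rmorph0.
Qed.

Definition ratmap_fun (d : nat) (phi : ratmap d) (P : proj rat 1) :
  proj rat 1 := pt (ratmap_coords_neq0 phi (coords_neq0 P)).

Lemma form_evalZ (K : comNzRingType) d (a : 'rV[K]_d.+1) (c : K) x :
  form_eval a (c *: x) = c ^+ d * form_eval a x.
Proof.
rewrite /form_eval mulr_sumr; apply: eq_bigr => j _; rewrite !mxE !exprMn.
have jd : (j <= d)%N by rewrite -ltnS.
by rewrite -[X in c ^+ X](subnK jd) exprD !mulrA; ring.
Qed.

(* The map does not depend on the choice of homogeneous coordinates. *)
Lemma ratmap_fun_pt d (phi : ratmap d) (x : 'rV[rat]_2) (x0 : x != 0) :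
  ratmap_fun phi (pt x0) = pt (ratmap_coords_neq0 phi x0).
Proof.
have /eqP/pt_eqP[c c0 xE] := pt_coords (pt x0).
apply/eqP/pt_eqP; exists (c ^+ d); first by rewrite expf_neq0.
by rewrite xE; apply/rowP => i; rewrite !mxE !form_evalZ; case: ifP.
Qed.

Definition preperiodic (T : Type) (f : T -> T) (x : T) : Prop :=
  exists n m : nat, (1 <= m)%N /\ iter (n + m) f x = iter n f x.

Lemma affine_pt_neq0 (alpha : rat) : row2 alpha 1 != 0.
Proof. by apply/eqP => /rowP/(_ 1)/eqP; rewrite !mxE oner_eq0. Qed.

Definition affine_pt (alpha : rat) : proj rat 1 := pt (affine_pt_neq0 alpha).

Definition formX1 (d : nat) : 'rV[rat]_d.+1 := delta_mx 0 ord_max.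

Lemma form_eval_formX1 d (x : 'rV[rat]_2) :
  form_eval (formX1 d) x = x 0 1 ^+ d.
Proof.
rewrite /form_eval (bigD1 ord_max) //= big1 ?addr0 => [|i /negPf iN].
  by rewrite !mxE !eqxx subnn expr0 !mul1r.
by rewrite !mxE iN !mul0r.
Qed.

Record polymap (d : nat) := PolyMap {
  polymap_form : 'rV[rat]_d.+1;
  polymap_no_common_zero : no_common_zero polymap_form (formX1 d)
}.
Arguments polymap_no_common_zero {d} phi [x] _ _ : rename.

Coercion ratmap_of_polymap (d : nat) (phi : polymap d) : ratmap d :=
  RatMap (polymap_no_common_zero phi).

(* The coordinates (a_0, ..., a_d, 1), where [a] is the row (a_0, ..., a_d). *)
Definition row_rcons1 (d : nat) (a : 'rV[rat]_d.+1) : 'rV[rat]_d.+2 :=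
  \row_(j < d.+2) (if unlift ord_max j is Some i then a 0 i else 1).

Lemma row_rcons1_neq0 d (a : 'rV[rat]_d.+1) : row_rcons1 a != 0.
Proof.
by apply/eqP => /rowP/(_ ord_max)/eqP; rewrite !mxE unlift_none oner_eq0.
Qed.

Definition polymap_height (R : realType) (d : nat) (phi : polymap d) : R :=
  height R (pt (row_rcons1_neq0 (polymap_form phi))).

(* Main.v *)
Require Import Defs.
From mathcomp Require Import all_boot all_order all_algebra.
From mathcomp Require Import reals.
From mathcomp Require Import exp zify.
Local Open Scope ring_scope.

Set Implicit Arguments.
Unset Strict Implicit.
Unset Printing Implicit Defensive.
Import Order.TTheory GRing.Theory Num.Theory.

(** Height $0$ forces the coefficients of the polynomial to be integers in
    $\{-1, 0, 1\}$, and the absence of a common zero at infinity forces the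
    leading one to be $\pm 1$.  For such a polynomial $f$ of degree $d \ge 2$
    two quantities escape along orbits.
    - If $x = p/q$ in lowest terms with $q > 1$, then $f(x)$ has denominator
      $q^d > q$, because the numerator $\pm p^d + q(\dots)$ remains prime to
      $q$ ([denq_form_eval]).
    - If $x$ is an integer with $N = |x| \ge 3$, then
      $|f(x)| \ge N^d - (N^d - 1)/(N - 1) \ge (N^d + 1)/2 > N$
      ([ltn_absz_form_eval]).
    A point at which some natural number grows strictly along the whole orbit
    is not preperiodic ([preperiodic_not_escaping]), so a preperiodic rational
    is an integer of absolute value at most $2$. *)

(** The set [D] is stable under [f] and the measure [mu] increases strictly
    along orbits inside it, so no point of [D] is preperiodic. *)
Lemma preperiodic_not_escaping (T : Type) (f : T -> T) (D : T -> Prop)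
    (mu : T -> nat) (x : T) :
  (forall y, D y -> D (f y) /\ (mu y < mu (f y))%N) ->
  preperiodic f x -> ~ D x.
Proof.
move=> fD [n [m [m_gt0 xE]]] Dx.
have Dit k : D (iter k f x) by elim: k => //= k /fD[].
have mu_le k l : (mu (iter k f x) + l <= mu (iter (k + l) f x))%N.
  elim: l => [|l IHl]; first by rewrite !addn0.
  by rewrite !addnS /=; apply: leq_ltn_trans IHl (fD _ (Dit _)).2.
by have := mu_le n m; rewrite xE; lia.
Qed.

(** The leading monomial is split off; all the others are divisible by [y]. *)
Lemma form_eval_row2_lead (K : comNzRingType) (d : nat) (a : 'rV[K]_d.+1)
    (x y : K) :
  form_eval a (row2 x y) =
  a 0 0 * x ^+ d
    + y * \sum_(j < d) a 0 (lift ord0 j) * x ^+ (d - j.+1) * y ^+ j.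
Proof.
rewrite /form_eval big_ord_recl !mxE /= subn0 expr0 mulr1 mulr_sumr.
congr (_ + _); apply: eq_bigr => j _; rewrite /bump /= add1n exprS.
by rewrite mulrCA.
Qed.

Lemma form_eval_intr (K : comNzRingType) (d : nat) (a : 'rV[int]_d.+1)
    (x y : int) :
  form_eval (map_mx intr a) (row2 x%:~R y%:~R) =
  (form_eval a (row2 x y))%:~R :> K.
Proof.
rewrite /form_eval rmorph_sum; apply: eq_bigr => j _.
by rewrite !mxE !rmorphM !rmorphXn.
Qed.

(** The dehomogenized form $f(x) = F(x, 1)$ with leading coefficient $\pm 1$
    raises denominators to the power $d$: after clearing denominators by
    homogeneity, its numerator is $\pm p^d$ modulo $q$. *)
Lemma denq_form_eval (d : nat) (a : 'rV[int]_d.+1) (x : rat) :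
  `|a 0%R 0%R|%N = 1%N ->
  denq (form_eval (map_mx intr a) (row2 x 1)) = denq x ^+ d.
Proof.
move=> a0; set p := numq x; set q := denq x.
have q0 : q%:~R != 0 :> rat by rewrite intr_eq0 denq_neq0.
have -> : row2 x 1 = q%:~R^-1 *: row2 p%:~R q%:~R.
  apply/rowP => i; rewrite !mxE; case: ifP => _; last by rewrite mulVf.
  by rewrite mulrC divq_num_den.
rewrite form_evalZ form_eval_intr exprVn mulrC -rmorphXn /=.
rewrite coprimeq_den; last first.
  rewrite abszX coprimeXr // form_eval_row2_lead -coprimezE.
  rewrite coprimez_sym addrC [q * _]mulrC /coprimez gcdzMDl -/(coprimez _ _).
  rewrite coprimezE abszM abszX a0 mul1n coprime_sym coprimeXl //.
  exact: coprime_num_den.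
rewrite expf_eq0 [q == 0](negPf (denq_neq0 x)) andbF.
by rewrite gtr0_norm // exprn_gt0 // denq_gt0.
Qed.

Lemma ltn_absz_form_eval (d : nat) (a : 'rV[int]_d.+1) (x : int) :
  (2 <= d)%N -> `|a 0%R 0%R|%N = 1%N -> (forall j, `|a 0%R j| <= 1)%N ->
  (3 <= `|x|)%N -> (`|x| < `|form_eval a (row2 x 1)|)%N.
Proof.
move=> d2 a0 a1 x3; rewrite form_eval_row2_lead mul1r.
set t := \sum_(j < d) _; set N := `|x|%N.
set S := (\sum_(j < d) N ^ j)%N.
(* The terms are bounded by $1, N, \dots, N^{d-1}$ in decreasing order. *)
have tS : (`|t| <= S)%N.
  rewrite -lez_nat abszE /t; apply: le_trans (ler_norm_sum _ _ _) _.
  rewrite /S (reindex_inj rev_ord_inj) /= -[leRHS]natz natr_sum.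
  apply: ler_sum => j _; rewrite expr1n mulr1 -abszE natz lez_nat.
  rewrite abszM abszX subnSK ?subKn //; last exact: ltnW.
  by rewrite -[leqRHS]mul1n leq_mul2r a1 orbT.
have SE : (N ^ d).-1 = (N.-1 * S)%N by rewrite predn_exp.
have hN : (N ^ 2 <= N ^ d)%N by rewrite leq_exp2l //; lia.
(* Since $N - 1 \ge 2$, the geometric sum is at most $(N^d - 1)/2$. *)
have SN : (2 * S <= N.-1 * S)%N by rewrite leq_mul2r; lia.
rewrite -SE in SN.
have h : (N ^ d <= `|(a 0 0 * x ^+ d + t)%R| + `|t|)%N.
  have : `|(a 0 0 * x ^+ d)%R|%N = (N ^ d)%N by rewrite abszM abszX a0 mul1n.
  lia.
have N3 : (3 * N <= N ^ 2)%N by rewrite -mulnn leq_mul2r x3 orbT.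
move: (absz (_ + t)) (absz t) (N ^ d)%N (N ^ 2)%N h tS SN hN N3 x3 => u v p r.
by rewrite -/N; lia.
Qed.

(** Height $0$ bounds the coprime integral coordinates by $1$; their maximal
    absolute value need not be shown positive, as [0] also meets the bound. *)
Lemma height_eq0_coprime_repr (R : realType) (n : nat) (P : proj rat n) :
  height R P = 0 -> forall i, (`|coprime_repr P 0%R i| <= 1)%N.
Proof.
rewrite /height; set M := (\max_i _)%N => M0 i.
apply: leq_trans (_ : M <= 1)%N; first exact: leq_bigmax.
have [-> //|M_gt0] := posnP M.
by move/eqP: M0; rewrite ln_eq0 ?ltr0n // pnatr_eq1 => /eqP->.
Qed.

Lemma coprime_repr_pt (n : nat) (x : 'rV[rat]_n.+1) (x0 : x != 0) :
  exists2 c : rat, c != 0 & map_mx intr (coprime_repr (pt x0)) = c *: x.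
Proof.
have /andP[cz zE] : coprime_coords (pt x0) (coprime_repr (pt x0)).
  exact: xchooseP.
have /eqP/pt_eqP[c c0 xE] := pt_coords (pt x0).
case/andP: zE => /sub_rVP[e zE] _; exists (e * c); last first.
  by rewrite zE xE scalerA.
apply: contraNneq (coprime_rV_neq0 cz) => ec0.
by rewrite zE xE scalerA ec0 scale0r.
Qed.

Lemma polymap_lead_neq0 (d : nat) (phi : polymap d) :
  (0 < d)%N -> polymap_form phi 0 0 != 0.
Proof.
move=> d0.
(* The point at infinity $(1 : 0)$ is already a zero of $X_1^d$. *)
have x0 : row2 1 0 != 0 :> 'rV[rat]_2.
  by apply/eqP => /rowP/(_ 0)/eqP; rewrite !mxE oner_eq0.
apply: contraNneq (ratmap_coords_neq0 phi x0) => a0.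
apply/eqP/rowP => i; rewrite !mxE /= form_eval_formX1 form_eval_row2_lead.
by rewrite a0 !mul0r addr0 !mxE /= expr0n eqn0Ngt d0; case: ifP.
Qed.

(** The coordinates $(a_0 : \dots : a_d : 1)$ are proportional to a vector with
    entries in $\{-1, 0, 1\}$ whose last entry is nonzero; dividing by that
    entry, a sign, shows that the coefficients $a_j$ lie in $\{-1, 0, 1\}$. *)
Lemma polymap_height_eq0 (R : realType) (d : nat) (phi : polymap d) :
  (0 < d)%N -> polymap_height R phi = 0 ->
  exists a : 'rV[int]_d.+1,
    [/\ polymap_form phi = map_mx intr a, `|a 0%R 0%R|%N = 1%N
      & forall j, (`|a 0%R j| <= 1)%N].
Proof.
move=> d0 /height_eq0_coprime_repr.
have [c c0] := coprime_repr_pt (row_rcons1_neq0 (polymap_form phi)).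
move: (coprime_repr _) => z /rowP zE z1.
have cE : c = (z 0 ord_max)%:~R.
  by have := zE ord_max; rewrite !mxE unlift_none mulr1.
have e1 : z 0 ord_max * z 0 ord_max = 1.
  have : z 0 ord_max != 0 by rewrite -(intr_eq0 rat) -cE.
  have := z1 ord_max; move: (z 0 ord_max) => e; nia.
(* The last coordinate is $\pm 1$, hence its own inverse. *)
pose a : 'rV[int]_d.+1 := \row_j (z 0 ord_max * z 0 (lift ord_max j)).
have aE : polymap_form phi = map_mx intr a.
  apply/rowP => j; have := zE (lift ord_max j); rewrite !mxE liftK => zj.
  by rewrite rmorphM /= zj cE mulrA -rmorphM /= e1 mul1r.
have a1 j : (`|a 0%R j| <= 1)%N.
  rewrite mxE abszM; exact: leq_mul (z1 ord_max) (z1 _).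
exists a; split=> //; have := polymap_lead_neq0 phi d0.
by rewrite aE mxE intr_eq0 => ?; have := a1 0; lia.
Qed.

Lemma ratmap_fun_affine_pt (d : nat) (phi : polymap d) (x : rat) :
  ratmap_fun phi (affine_pt x) =
  affine_pt (form_eval (polymap_form phi) (row2 x 1)).
Proof.
rewrite ratmap_fun_pt; apply/eqP/pt_eqP; exists 1; first exact: oner_neq0.
rewrite scale1r; apply/rowP => i; rewrite !mxE /= form_eval_formX1 !mxE /=.
by rewrite expr1n.
Qed.

Lemma affine_pt_inj : injective affine_pt.
Proof.
move=> x y /eqP/pt_eqP[c _ /rowP xyE].
have := xyE 1; have := xyE 0; rewrite !mxE /= mulr1 => -> <-.
by rewrite mul1r.
Qed.

Lemma preperiodic_affine_pt (d : nat) (phi : polymap d) (x : rat) :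
  preperiodic (ratmap_fun phi) (affine_pt x) ->
  preperiodic (fun y => form_eval (polymap_form phi) (row2 y 1)) x.
Proof.
set f := fun y => _; have iterE k :
    iter k (ratmap_fun phi) (affine_pt x) = affine_pt (iter k f x).
  by elim: k => //= k ->; rewrite ratmap_fun_affine_pt.
case=> n [m [m_gt0 xE]]; exists n, m; split=> //.
by apply: affine_pt_inj; rewrite -!iterE.
Qed.

Theorem theorem1p4 (R : realType) (d : nat) (hd : (2 <= d)%N)
    (phi : polymap d) (hphi : polymap_height R phi = 0)
    (alpha : rat) (halpha : preperiodic (ratmap_fun phi) (affine_pt alpha)) :
  alpha \in [:: 0; 1; -1; 2; -2].
Proof.
have [a [aE a0 a1]] := polymap_height_eq0 (ltnW hd) hphi.
have := preperiodic_affine_pt halpha; rewrite aE => {}halpha.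
have den1 : ~ (1 < `|denq alpha|)%N.
  move: halpha; apply: (preperiodic_not_escaping
    (D := fun y => is_true (1 < `|denq y|)%N) (mu := fun y => `|denq y|%N)).
  move=> y y1; rewrite denq_form_eval // abszX.
  have lt_y : (`|denq y| < `|denq y| ^ d)%N.
    by rewrite -[ltnLHS]expn1 ltn_exp2l.
  by split=> //; apply: ltn_trans lt_y.
have alphaE : alpha = (numq alpha)%:~R.
  apply/esym/numqK; rewrite Qint_def.
  by have := denq_gt0 alpha; move: den1; lia.
have num3 : ~ (alpha = (numq alpha)%:~R /\ (3 <= `|numq alpha|)%N).
  move: halpha; apply: (preperiodic_not_escaping
    (D := fun y => y = (numq y)%:~R /\ (3 <= `|numq y|)%N)
    (mu := fun y => `|numq y|%N)).
  move=> y [yE y3].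
  rewrite yE -[X in row2 _ X]/(1%:~R) form_eval_intr !numq_int.
  have lt_y := ltn_absz_form_eval hd a0 a1 y3.
  by split=> //; split=> //; apply: leq_trans y3 (ltnW lt_y).
have {num3}: (`|numq alpha| < 3)%N.
  by rewrite ltnNge; apply/negP => ?; apply: num3.
by rewrite alphaE numq_int; move: (numq alpha) => [[|[|[|n]]]|[|[|n]]].
Qed.
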